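(* There is a function $f\colon\mathbb{Z}_{\ge1}\to\mathbb{R}_{\geq 0}$ with $f(d)=d^{O(d)}$ such that for all integers $d\ge 1$ and $n\ge 2$, the dual graph $G_{d,n}=\Gamma\big(((\mathbf{H}^{2d,n})'')_d\big)$ of the $d$-skeleton of the second barycentric subdivision of the $2d$-dimensional hypercubic honeycomb $\mathbf{H}^{2d,n}$ satisfies $$\operatorname{tww}(G_{d,n})\le f(d).$$
   Context: Notation $f(d)=d^{O(d)}$: there are constants $C,d_0>0$ with $f(d)\le d^{Cd}$ for all $d\ge d_0$. Hypercubic honeycomb: for positive integers $k,n$, $\mathbf{H}^{k,n}$ is the cubical $k$-complex that decomposes $[1,n]^k\subset\mathbb{R}^k$ into $(n-1)^k$ unit cubes with integral vertices; its cubes are all the products $I_1\times\cdots\times I_k$ where each $I_j$ is either a single integer point $\{a\}$ with $1\le a\le n$ or an interval $[a,a+1]$ with $a$ an integer, $1\le a\le n-1$. Barycentric subdivision: for a cubical or simplicial complex $X$, its barycentric subdivision $X'$ is the simplicial complex whose vertices are the (nonempty) faces of $X$ and whose $k$-simplices are the sets $\{\sigma_0,\ldots,\sigma_k\}$ of $k+1$ distinct faces with $\sigma_0\subset\sigma_1\subset\cdots\subset\sigma_k$. $X''=(X')'$. Skeleton and dual graph: the $i$-skeleton $X_i$ of a complex $X$ is the subcomplex of all faces of dimension at most $i$. For a pure complex $X$ (every face lies in a face of dimension $\dim X$) and $i\le\dim X$, $\Gamma(X_i)$ is the simple graph whose vertices are the $i$-faces of $X$, two being adjacent if and only if they share an $(i-1)$-dimensional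 face. Twin-width: a trigraph is a triple $G=(V,E,R)$ with $V$ a finite set and $E,R\subseteq\binom{V}{2}$ disjoint sets of black and red edges; a simple graph is a trigraph with $R=\emptyset$. The red degree of a vertex is the number of red edges incident to it. For distinct $u,v\in V$, the contraction $G/u,v=(V',E',R')$ has $V'=(V\setminus\{u,v\})\cup\{w\}$ for a new vertex $w$; all (black/red) edges among vertices of $V\setminus\{u,v\}$ are unchanged; and for $x\in V\setminus\{u,v\}$: $\{w,x\}\in E'$ iff $\{u,x\}\in E$ and $\{v,x\}\in E$; $\{w,x\}\notin E'\cup R'$ iff $\{u,x\}\notin E\cup R$ and $\{v,x\}\notin E\cup R$; and $\{w,x\}\in R'$ otherwise. A contraction sequence is a sequence of trigraphs each of which (after the first) is a contraction of the preceding one; its width is the maximum red degree of any vertex in any trigraph of the sequence. The twin-width $\operatorname{tww}(G)$ is the minimum width of a contraction sequence starting at $G$ and ending at a one-vertex trigraph. *)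

(* Defs.v *)
From HB Require Import structures.
From mathcomp Require Import all_boot all_order all_algebra.
From mathcomp Require Import reals exp.

Set Implicit Arguments.
Unset Strict Implicit.
Unset Printing Implicit Defensive.

(* A finite cubical or simplicial complex, given by its nonempty faces, the
   inclusion relation between them, and their dimensions. *)
Record complex := Complex {
  face :> finType;
  subface : rel face;
  fdim : face -> nat;
  subface_refl : reflexive subface;
  subface_anti : antisymmetric subface;
  subface_trans : transitive subface;
  fdim_strict : forall s t, subface s t -> s != t -> fdim s < fdim t }.

Section Honeycomb.
Variables k n : nat.

(* (a, b) encodes the real interval [a, b]; the condition leaves exactly the
   points [a, a] with 1 <= a <= n and the unit intervals [a, a + 1] with
   1 <= a <= n - 1. *)
Definition elem_interval :=
  {I : 'I_n.+1 * 'I_n.+1 | [&& 0 < I.1, I.1 <= I.2 & I.2 <= I.1.+1]}.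

Definition lo (I : elem_interval) : nat := (val I).1.
Definition hi (I : elem_interval) : nat := (val I).2.

Definition cube := {ffun 'I_k -> elem_interval}.

(* The factors are nonempty, so inclusion of products of intervals is
   coordinatewise inclusion. *)
Definition subcube : rel cube :=
  fun c c' => [forall j, (lo (c' j) <= lo (c j)) && (hi (c j) <= hi (c' j))].

Definition cube_dim (c : cube) : nat := \sum_j (hi (c j) - lo (c j)).

Lemma lo_le_hi I : lo I <= hi I.
Proof. by rewrite /lo /hi; case/and3P: (valP I). Qed.

Lemma elem_interval_inj I J : lo I = lo J -> hi I = hi J -> I = J.
Proof.
rewrite /lo /hi => /val_inj el /val_inj eh; apply: val_inj.
by rewrite [LHS]surjective_pairing el eh -surjective_pairing.
Qed.

Lemma subcube_refl : reflexive subcube.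
Proof. by move=> c; apply/forallP => j; rewrite !leqnn. Qed.

Lemma subcube_anti : antisymmetric subcube.
Proof.
move=> c c' /andP[/forallP h /forallP h']; apply/ffunP => j.
have /andP[l1 u1] := h j; have /andP[l2 u2] := h' j.
by apply: elem_interval_inj; apply/eqP; rewrite eqn_leq ?l1 ?l2 ?u1 ?u2.
Qed.

Lemma subcube_trans : transitive subcube.
Proof.
move=> b a c /forallP h /forallP h'; apply/forallP => j.
have /andP[l1 u1] := h j; have /andP[l2 u2] := h' j.
by rewrite (leq_trans l2 l1) (leq_trans u1 u2).
Qed.

Lemma cube_dim_strict c c' :
  subcube c c' -> c != c' -> cube_dim c < cube_dim c'.
Proof.
move=> /forallP h; rewrite ltn_neqAle /cube_dim.
have H j : true -> hi (c j) - lo (c j) <= hi (c' j) - lo (c' j) ?= iff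
    (c j == c' j).
  move=> _; have /andP[l1 u1] := h j; split; first exact: leq_sub.
  apply/eqP/eqP => [e|->//]; have := lo_le_hi (c j) => l2.
  have e2 : hi (c j) + lo (c' j) = hi (c' j) + lo (c j).
    rewrite -(subnK l2) -[in RHS](subnK (lo_le_hi (c' j))) e -!addnA.
    by congr (_ + _); rewrite addnC.
  have eh : hi (c j) = hi (c' j).
    apply/eqP; rewrite eqn_leq u1 -(leq_add2r (lo (c' j))) e2 leq_add2l.
    by [].
  apply: elem_interval_inj => //.
  by move: e2; rewrite eh => /addnI.
have [-> ->] := leqif_sum H; rewrite andbT; apply: contraNN => /forallP e.
by apply/eqP/ffunP => j; apply/eqP; apply: e.
Qed.

Definition honeycomb : complex :=
  Complex subcube_refl subcube_anti subcube_trans cube_dim_strict.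

End Honeycomb.

Section Barycentric.
Variable X : complex.

Definition is_flag (s : {set X}) : bool :=
  (s != set0) &&
  [forall x in s, forall y in s, subface x y || subface y x].

Definition flag := {s : {set X} | is_flag s}.

Definition subflag : rel flag := fun s t => val s \subset val t.

Definition flag_dim (s : flag) : nat := #|val s|.-1.

Lemma subflag_refl : reflexive subflag.
Proof. by move=> s; apply: subxx. Qed.

Lemma subflag_anti : antisymmetric subflag.
Proof. by move=> s t st; apply/val_inj/eqP; rewrite eqEsubset. Qed.

Lemma subflag_trans : transitive subflag.
Proof. by move=> t s u; apply: subset_trans. Qed.

Lemma flag_dim_strict s t : subflag s t -> s != t -> flag_dim s < flag_dim t.
Proof.
move=> st ne; have/proper_card lt : val s \proper val t.
  by rewrite properEneq (inj_eq val_inj) ne.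
have s_gt0 : 0 < #|val s| by rewrite card_gt0; case/andP: (valP s).
by rewrite /flag_dim -ltnS !prednK // (leq_trans s_gt0 (ltnW lt)).
Qed.

Definition barycentric : complex :=
  Complex subflag_refl subflag_anti subflag_trans flag_dim_strict.

End Barycentric.

Section Skeleton.
Variables (i : nat) (X : complex).

Definition skel_face := {x : X | fdim x <= i}.
Definition skel_sub : rel skel_face := fun x y => subface (val x) (val y).
Definition skel_dim (x : skel_face) : nat := fdim (val x).

Lemma skel_refl : reflexive skel_sub.
Proof. by move=> x; apply: subface_refl. Qed.

Lemma skel_anti : antisymmetric skel_sub.
Proof. by move=> x y /subface_anti/val_inj. Qed.

Lemma skel_trans : transitive skel_sub.
Proof. by move=> y x z; apply: subface_trans. Qed.

Lemma skel_dim_strict x y : skel_sub x y -> x != y -> skel_dim x < skel_dim y.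
Proof. by move=> xy ne; apply: fdim_strict; rewrite ?(inj_eq val_inj). Qed.

Definition skeleton : complex :=
  Complex skel_refl skel_anti skel_trans skel_dim_strict.

End Skeleton.

Record graph := Graph {
  gvertex :> finType;
  adj : rel gvertex;
  adj_sym : symmetric adj;
  adj_irr : irreflexive adj }.

Section DualGraph.
Variables (i : nat) (X : complex).

Definition dual_vertex := {x : X | fdim x == i}.

(* Dimension i - 1 is written (fdim z).+1 == i to avoid truncated
   subtraction; complexes have no empty face, so the notion is meant for
   i >= 1. *)
Definition dual_adj : rel dual_vertex := fun x y =>
  (x != y) &&
  [exists z : X,
    [&& (fdim z).+1 == i, subface z (val x) & subface z (val y)]].

Lemma dual_adj_sym : symmetric dual_adj.
Proof.
move=> x y; rewrite /dual_adj eq_sym; congr (_ && _).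
by apply: eq_existsb => z; rewrite [subface _ _ && _]andbC.
Qed.

Lemma dual_adj_irr : irreflexive dual_adj.
Proof. by move=> x; rewrite /dual_adj eqxx. Qed.

Definition dual_graph : graph := Graph dual_adj_sym dual_adj_irr.

End DualGraph.

Record trigraph := Trigraph {
  tvertex :> finType;
  black : rel tvertex;
  red : rel tvertex;
  black_sym : symmetric black;
  black_irr : irreflexive black;
  red_sym : symmetric red;
  red_irr : irreflexive red;
  black_red_disjoint : forall x y, ~~ (black x y && red x y) }.

Section OfGraph.
Variable G : graph.

Definition no_red : rel G := fun _ _ => false.

Lemma no_red_disjoint x y : ~~ (adj x y && no_red x y).
Proof. by rewrite andbF. Qed.

Definition trigraph_of : trigraph :=
  @Trigraph G (@adj G) no_red (@adj_sym G) (@adj_irr G)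
    (fun _ _ => erefl) (fun _ => erefl) no_red_disjoint.

End OfGraph.

Section Contraction.
Variables (G : trigraph) (u v : G).

(* [None] is the new vertex w. *)
Definition contract_vertex := option {x : G | (x != u) && (x != v)}.

Definition nonadj (x y : G) : bool := ~~ (black x y || red x y).

Definition w_black (x : G) : bool := black u x && black v x.
Definition w_nonadj (x : G) : bool := nonadj u x && nonadj v x.
Definition w_red (x : G) : bool := ~~ w_black x && ~~ w_nonadj x.

Definition contract_black : rel contract_vertex := fun a b =>
  match a, b with
  | Some x, Some y => black (val x) (val y)
  | None, Some x | Some x, None => w_black (val x)
  | None, None => false
  end.

Definition contract_red : rel contract_vertex := fun a b =>
  match a, b with
  | Some x, Some y => red (val x) (val y)
  | None, Some x | Some x, None => w_red (val x)
  | None, None => false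
  end.

Lemma contract_black_sym : symmetric contract_black.
Proof. by move=> [x|] [y|] //=; apply: black_sym. Qed.

Lemma contract_black_irr : irreflexive contract_black.
Proof. by move=> [x|] //=; apply: black_irr. Qed.

Lemma contract_red_sym : symmetric contract_red.
Proof. by move=> [x|] [y|] //=; apply: red_sym. Qed.

Lemma contract_red_irr : irreflexive contract_red.
Proof. by move=> [x|] //=; apply: red_irr. Qed.

Lemma contract_disjoint a b : ~~ (contract_black a b && contract_red a b).
Proof.
case: a b => [x|] [y|] //=; first exact: black_red_disjoint.
  by rewrite /w_red; case: w_black.
by rewrite /w_red; case: w_black.
Qed.

Definition contract : trigraph :=
  Trigraph contract_black_sym contract_black_irr
    contract_red_sym contract_red_irr contract_disjoint.

End Contraction.

Definition is_contraction (G H : trigraph) : Prop :=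
  exists u v : G, u != v /\ H = contract u v.

(* The trigraph sequence is G :: s. *)
Fixpoint contraction_sequence (G : trigraph) (s : seq trigraph) : Prop :=
  match s with
  | [::] => True
  | H :: s' => is_contraction G H /\ contraction_sequence H s'
  end.

Definition red_degree (G : trigraph) (x : G) : nat := #|[set y | red x y]|.

Definition width (s : seq trigraph) : nat :=
  \max_(G <- s) \max_(x : G) red_degree x.

Definition has_sequence_of_width (G : trigraph) (k : nat) : Prop :=
  exists s : seq trigraph,
    [/\ contraction_sequence G s, #|last G s| = 1 & width (G :: s) = k].

(* tww(G) = k *)
Definition is_twin_width (G : graph) (k : nat) : Prop :=
  has_sequence_of_width (trigraph_of G) k /\
  forall l, has_sequence_of_width (trigraph_of G) l -> k <= l.

Definition G_dn (d n : nat) : graph :=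
  dual_graph d (skeleton d (barycentric (barycentric (honeycomb (2 * d) n)))).

Local Open Scope ring_scope.

(* f(d) = d^{O(d)} *)
Definition d_pow_O_d (R : realType) (f : nat -> R) : Prop :=
  exists C d0 : R, [/\ 0 < C, 0 < d0 &
    forall d : nat, d0 <= d%:R -> f d <= d%:R `^ (C * d%:R)].

(* Main.v *)
(* Place every d-simplex at the lower corner of a cube common to all its
   vertices (which are flags of cubes). Simplices sharing a (d-1)-simplex share
   a flag, so their positions differ by at most 1 in each coordinate. Contract
   the simplices with equal positions, then merge positions along dyadic boxes
   of side 2, 4, 8, and so on. At every stage a part meets only parts lying in
   the 3^(2d) boxes around its own box, so the red degree is at most
   max(6^(2d), N) with N the number of d-simplices near a given position. N is
   d^O(d) because along a flag of cubes each coordinate changes at most once. *)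
Require Import Defs.
From mathcomp Require Import all_boot all_order all_algebra.
From mathcomp Require Import reals exp boolp zify.

Set Implicit Arguments.
Unset Strict Implicit.
Unset Printing Implicit Defensive.

(** * Counting by codes, and minima with a default value *)

(** Choosing one code for each element gives an injection; [R] is only a relation, so an element may
    have several codes. *)
Lemma card_le_code (X T : finType) (A : {pred X}) (C : {pred T})
    (R : T -> X -> Prop) :
    (forall x, x \in A -> exists2 c, c \in C & R c x) ->
    (forall c x y, x \in A -> y \in A -> R c x -> R c y -> x = y) ->
  #|A| <= #|C|.
Proof.
move=> exR injR; case: (pickP (mem A)) => [x0 Ax0|A0]; last by rewrite eq_card0.
have [c0 _ _] := exR _ Ax0.
have /fin_all_exists[f fP] x : exists c, x \in A -> c \in C /\ R c x.
  case: (boolP (x \in A)) => [/exR[c Cc Rc]|_]; first by exists c.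
  by exists c0.
have injf : {in A &, injective f}.
  move=> x y Ax Ay fxy; apply: (injR (f x)) => //; first exact: (fP x Ax).2.
  by rewrite fxy; apply: (fP y Ay).2.
rewrite -(card_in_image injf); apply/subset_leq_card/subsetP => c.
by case/imageP=> x Ax ->; apply: (fP x Ax).1.
Qed.

(** The cap [N] plays the role of infinity: it exceeds every value on [P] and is the default when
    [P] is empty. *)
Lemma capped_min (T : finType) (P : pred T) (f : T -> nat) (N : nat) :
    (forall x, P x -> f x < N) ->
  exists m : 'I_N.+1, (forall x, P x -> m <= f x) /\
    (m < N -> exists2 x, P x & f x = m).
Proof.
move=> ltN; case: (pickP P) => [x0 Px0|P0]; last first.
  by exists ord_max; split=> [x|/=]; rewrite ?P0 ?ltnn.
case: (arg_minnP f Px0) => x Px minx.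
have lt : f x < N.+1 by rewrite ltnS ltnW ?ltN.
exists (Ordinal lt); split=> [y /minx //|_]; by exists x.
Qed.

(** * Contraction sequences between two partitions of a graph *)

Section Contractions.
Variables (G : graph) (B : nat).

Definition reaches (H K : trigraph) : Prop :=
  exists s, [/\ contraction_sequence H s, last H s = K & width (H :: s) <= B].

Lemma reaches_trans H K L : reaches H K -> reaches K L -> reaches H L.
Proof.
move=> [s [cs ls ws]] [t [ct lt wt]]; exists (s ++ t); split.
- elim: s H cs ls {ws} => [|I s IHs] H /= => [_ -> //|[HI cs] ls].
  by split=> //; apply: IHs.
- by rewrite last_cat ls.
- move: ws wt; rewrite /width !big_cons big_cat !geq_max.
  by move=> /andP[-> ->] /andP[_ ->].
Qed.

(* [pi] exhibits [H] as the result of contracting parts of [G]: every edge of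
   [H], black or red, comes from an edge of [G]. *)
Definition quotient_map (H : trigraph) (pi : G -> H) : Prop :=
  (forall a, exists x, pi x = a) /\
  (forall a b, ~~ nonadj a b -> exists x y, [/\ pi x = a, pi y = b & adj x y]).

Lemma quotient_map_id : @quotient_map (trigraph_of G) id.
Proof.
split=> [a|a b]; first by exists a.
by rewrite negbK orbF => ab; exists a, b.
Qed.

Definition contract_map (H : trigraph) (u v a : H) : contract u v :=
  insub a : option {x : H | (x != u) && (x != v)}.

Lemma contract_mapP (H : trigraph) (u v a b : H) :
  (contract_map u v a = contract_map u v b) <->
  a = b \/ (a \in [:: u; v]) /\ (b \in [:: u; v]).
Proof.
have inE2 c : (c \in [:: u; v]) = ~~ ((c != u) && (c != v)).
  by rewrite !inE negb_and !negbK.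
rewrite /contract_map !inE2.
case: insubP => [x Px ax|/negPf nPa]; case: insubP => [y Py yb|/negPf nPb].
- rewrite Px; split=> [[xy]|[ab|[]//]]; first by left; rewrite -ax xy.
  by congr Some; apply: val_inj; rewrite ax yb.
- by rewrite Px; split=> // -[ab|[]//]; rewrite -ab Px in nPb.
- by rewrite Py; split=> // -[ab|[]//]; rewrite ab Py in nPa.
- by rewrite nPa nPb; split=> // _; right.
Qed.

Lemma contract_map_Some (H : trigraph) (u v : H) x :
  contract_map u v (val x) = Some x.
Proof. by rewrite /contract_map valK. Qed.

Lemma contract_map_end (H : trigraph) (u v a : H) :
  a \in [:: u; v] -> contract_map u v a = None.
Proof.
by rewrite !inE => a_uv; rewrite /contract_map insubN // negb_and !negbK.
Qed.

Lemma quotient_map_contract (H : trigraph) (pi : G -> H) (u v : H) :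
  quotient_map pi -> quotient_map (contract_map u v \o pi).
Proof.
move=> [surj edge]; split=> [[a|]|].
- have [x xa] := surj (val a); exists x => /=; rewrite xa; exact: contract_map_Some.
- by have [x xu] := surj u; exists x; rewrite /= xu contract_map_end ?mem_head.
have lift (b : {x : H | (x != u) && (x != v)}) c :
    c \in [:: u; v] -> ~~ nonadj c (val b) ->
    exists x y : G, [/\ contract_map u v (pi x) = None,
                        contract_map u v (pi y) = Some b & adj x y].
  move=> c_uv /edge[x [y [xc yb xy]]]; exists x, y.
  by rewrite xc yb contract_map_end // contract_map_Some.
have edge_w (b : {x : H | (x != u) && (x != v)}) :
    w_black u v (val b) || w_red u v (val b) ->
    exists x y : G, [/\ contract_map u v (pi x) = None,
                        contract_map u v (pi y) = Some b & adj x y].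
  (* An edge at the new vertex, black or red, comes from an edge at [u] or at [v], which lifts to
     [G]. *)
  move=> wb; have : ~~ nonadj u (val b) || ~~ nonadj v (val b).
    move: wb; rewrite -negb_and => /orP[/andP[bu _]|/andP[_ //]].
    by rewrite /nonadj bu.
  by case/orP; apply: lift; rewrite ?inE ?eqxx ?orbT.
move=> [a|] [b|]; rewrite /nonadj negbK //=.
- rewrite -[_ || _]negbK => /edge[x [y [xa yb xy]]]; exists x, y.
  by rewrite xa yb !contract_map_Some.
- by case/edge_w=> x [y [xn ya xy]]; exists y, x; rewrite adj_sym.
- by move/edge_w.
Qed.

Lemma card_contract (H : trigraph) (u v : H) : u != v -> #|contract u v| < #|H|.
Proof.
move=> uv; rewrite card_option card_sig.
rewrite (cardD1 u H) (cardD1 v [predD1 H & u]) !inE eq_sym uv /= add1n !ltnS.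
by apply/subset_leq_card/subsetP => x; rewrite !inE => /andP[-> ->].
Qed.

(* A part of a partition between [q] and [p] lies in one class of [p], and its
   red neighbours contain distinct classes of [q], each adjacent to that class
   of [p]; [degB] counts these classes of [q]. *)
Variables (S T : finType) (q : G -> S) (p : G -> T).
Hypothesis degB : forall x0,
  #|[set q y | y in [set y | [exists x, (p x == p x0) && adj x y]]]| <= B.

Definition between (H : trigraph) (pi : G -> H) : Prop :=
  (forall x y, q x = q y -> pi x = pi y) /\
  (forall x y, pi x = pi y -> p x = p y).

Lemma width_between (H : trigraph) (pi : G -> H) :
  quotient_map pi -> between pi -> width [:: H] <= B.
Proof.
move=> [surj edge] [qpi pip]; rewrite /width big_seq1; apply/bigmax_leqP => a _.
have [x0 x0a] := surj a; apply: leq_trans (degB x0); rewrite /red_degree.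
(* A red neighbour is coded by a class of [q] inside it; [pi] is constant on that class, so the
   class determines the neighbour. *)
apply: (@card_le_code _ _ _ _ (fun c b => exists2 y, pi y = b & q y = c)).
  move=> b; rewrite inE => ab; have [|x [y [xa yb xy]]] := edge a b.
    by rewrite negbK ab orbT.
  exists (q y); last by exists y.
  apply/imsetP; exists y => //; rewrite inE; apply/existsP; exists x.
  by rewrite xy andbT; apply/eqP/pip; rewrite xa x0a.
by move=> c b b' _ _ [y <- qy] [y' <- qy']; apply: qpi; rewrite qy qy'.
Qed.

(** Induction on the number of vertices: while some class of [p] meets two parts, these are
    contracted, and the partition stays between [q] and [p]. *)
Lemma coarsen (H : trigraph) (pi : G -> H) :
    quotient_map pi -> between pi ->
  exists (K : trigraph) (rho : G -> K), [/\ reaches H K, quotient_map rho &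
    forall x y, rho x = rho y <-> p x = p y].
Proof.
have [m] := ubnP #|H|; elim: m H pi => // m IHm H pi ltm Qpi bpi.
case: (pickP [pred xy : G * G | (p xy.1 == p xy.2) && (pi xy.1 != pi xy.2)]).
  move=> [x y] /= /andP[/eqP pxy neq]; set u := pi x; set v := pi y.
  have Q' := quotient_map_contract u v Qpi.
  have b' : between (contract_map u v \o pi).
    split=> [z t /bpi.1 /= ->//|z t /contract_mapP[/bpi.2 //|]].
    have pE w : pi w \in [:: u; v] -> p w = p x.
      by rewrite !inE => /orP[] /eqP/bpi.2 ->.
    by case=> /pE-> /pE->.
  have [|K [rho [HK Qrho rhoP]]] := IHm _ _ _ Q' b'.
    by rewrite -ltnS (leq_trans _ ltm) // ltnS card_contract.
  exists K, rho; split=> //; apply: reaches_trans HK.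
  exists [:: contract u v]; split=> //=; first by split=> //; exists u, v.
  have := width_between Qpi bpi; have := width_between Q' b'.
  by rewrite /width !big_cons !big_nil !geq_max => /andP[-> _] /andP[-> _].
move=> none; exists H, pi; split=> // [|x y].
  by exists [::]; split=> //; exact: width_between Qpi bpi.
split=> [/bpi.2//|pxy]; apply/eqP; move/negbT: (none (x, y)).
by rewrite /= pxy eqxx /= negbK.
Qed.

End Contractions.

(** * Twin-width of graphs with positions in a grid *)

Section GridGraph.
Variables (G : graph) (k n B : nat) (pos : G -> {ffun 'I_k -> 'I_n.+1}).
Hypothesis pos_adj : forall x y, adj x y -> forall j, pos x j <= (pos y j).+1.
Hypothesis boxB : 6 ^ k <= B.
Hypothesis nearB : forall x0, #|[set y | [forall j,
  (pos y j <= pos x0 j + 1) && (pos x0 j <= pos y j + 1)]]| <= B.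

(** The index of the dyadic box of side [2 ^ l]; quotients stay at most [n], so [inord] never falls
    back to its default. *)
Definition scaled (l : nat) (x : G) : {ffun 'I_k -> 'I_n.+1} :=
  [ffun j => inord (pos x j %/ 2 ^ l)].

Lemma scaledE l x j : scaled l x j = pos x j %/ 2 ^ l :> nat.
Proof.
by rewrite ffunE inordK // (leq_ltn_trans (leq_div _ _)).
Qed.

Lemma scaled_eq l x y :
  scaled l x = scaled l y <-> forall j, pos x j %/ 2 ^ l = pos y j %/ 2 ^ l.
Proof.
split=> [xy j|xy]; first by rewrite -!scaledE xy.
by apply/ffunP=> j; apply: val_inj; rewrite /= !scaledE.
Qed.

Lemma scaledS l x j : scaled l.+1 x j = scaled l x j %/ 2 :> nat.
Proof. by rewrite !scaledE expnSr divnMA. Qed.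

Lemma scaled_adj l x y : adj x y -> forall j, scaled l x j <= (scaled l y j).+1.
Proof.
move=> xy j; rewrite !scaledE; have l_gt0 : 0 < 2 ^ l by rewrite expn_gt0.
have le_pos : pos x j <= pos y j + 2 ^ l by have := pos_adj xy j; lia.
have := leq_div2r (2 ^ l) le_pos.
by rewrite divnDr ?dvdnn // divnn l_gt0 addn1.
Qed.

(** If a box of level [l.+1] has coordinate [a], its neighbours have coordinates from [a - 1] to
    [a + 1], hence level-[l] coordinates from [2a - 2] to [2a + 3]: six values. The shift by 2
    avoids negative numbers. *)
Lemma scaled_degree l x0 :
  #|[set scaled l y | y in [set y |
      [exists x, (scaled l.+1 x == scaled l.+1 x0) && adj x y]]]| <= B.
Proof.
apply: leq_trans boxB.
have <- : #|{ffun 'I_k -> 'I_6}| = 6 ^ k by rewrite card_ffun !card_ord.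
pose a j := scaled l.+1 x0 j : nat.
apply: (card_le_code (R := fun (c : {ffun 'I_k -> 'I_6})
    (v : {ffun 'I_k -> 'I_n.+1}) =>
  forall j, v j + 2 = (a j).*2 + c j)) => [v|c v w _ _ vP wP]; last first.
  by apply/ffunP => j; apply: val_inj => /=; have := vP j; have := wP j; lia.
case/imsetP => y; rewrite inE => /existsP[x /andP[/eqP xx0 xy]] ->.
have /fin_all_exists[c cP] j : exists c : 'I_6, scaled l y j + 2 = (a j).*2 + c.
  have ax : a j = scaled l.+1 x j by rewrite xx0.
  have yx : adj y x by rewrite adj_sym.
  have := scaled_adj l.+1 xy j; have := scaled_adj l.+1 yx j.
  rewrite -{}ax !scaledS => h1 h2.
  have lt : scaled l y j + 2 - (a j).*2 < 6 by lia.
  by exists (Ordinal lt) => /=; lia.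
by exists (finfun c) => // j; rewrite cP ffunE.
Qed.

(** The first stage starts from single vertices, so neighbours are counted one by one by [nearB]
    rather than by boxes. *)
Lemma pos_degree x0 :
  #|[set y | y in [set y |
      [exists x, (scaled 0 x == scaled 0 x0) && adj x y]]]| <= B.
Proof.
apply: leq_trans (nearB x0); rewrite imset_id; apply/subset_leq_card/subsetP=> y.
rewrite !inE => /existsP[x /andP[/eqP/scaled_eq xx0 xy]]; apply/forallP => j.
have := xx0 j; rewrite !divn1 => <-; have yx : adj y x by rewrite adj_sym.
by rewrite !addn1 !pos_adj.
Qed.

Lemma reaches_scaled l :
  exists (K : trigraph) (rho : G -> K),
    [/\ reaches B (trigraph_of G) K, quotient_map rho &
        forall x y, rho x = rho y <-> scaled l x = scaled l y].
Proof.
elim: l => [|l [H [pi [GH Qpi piP]]]].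
  apply: (coarsen pos_degree (quotient_map_id G)).
  by split=> [x y //|x y ->].
have [|K [rho [HK Qrho rhoP]]] := coarsen (@scaled_degree l) Qpi.
  split=> x y; first by move/piP.
  move/piP/scaled_eq => xy; apply/scaled_eq => j.
  by rewrite expnSr !divnMA xy.
by exists K, rho; split=> //; apply: reaches_trans HK.
Qed.

Lemma grid_graph_twin_width : G -> exists2 m, is_twin_width G m & m <= B.
Proof.
move=> x0; have [K [rho [[s [cs lasts ws]] [surj _] rhoP]]] := reaches_scaled n.+1.
have const a b : a = b :> K.
  have [x <-] := surj a; have [y <-] := surj b; apply/rhoP/scaled_eq => j.
  (* At level [n.+1] one box holds all positions, so a single vertex remains. *)
  have lt z : pos z j < 2 ^ n.+1
    by exact: ltn_trans (ltn_ord _) (ltn_expl _ _).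
  by rewrite !divn_small.
pose P m : bool := `[< has_sequence_of_width (trigraph_of G) m >].
have Pw : exists m, P m.
  exists (width (trigraph_of G :: s)); apply/asboolP; exists s; split=> //.
  by rewrite lasts; apply/eqP/fintype1P; exists (rho x0) => a.
case: (ex_minnP Pw) => m /asboolP Pm min; exists m.
  by split=> // l Pl; apply/min/asboolP.
apply: leq_trans ws; apply/min/asboolP; exists s; split=> //.
by rewrite lasts; apply/eqP/fintype1P; exists (rho x0) => a.
Qed.

End GridGraph.

(** * Flags, and flags of flags *)

Section FlagFacts.
Variable X : complex.

Lemma flag_comparable (F : flag X) (x y : X) :
  x \in val F -> y \in val F -> subface x y || subface y x.
Proof. by case/andP: (valP F) => _ /forall_inP h /h /forall_inP; apply. Qed.

Lemma flag_nonempty (F : flag X) : exists x, x \in val F.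
Proof. by case/andP: (valP F) => /set0Pn. Qed.

Lemma flag_subface (F : flag X) (x y : X) :
  x \in val F -> y \in val F -> fdim x <= fdim y -> subface x y.
Proof.
move=> Fx Fy le; case/orP: (flag_comparable Fx Fy) => // yx.
have [->|ne] := eqVneq y x; first exact: subface_refl.
by have := fdim_strict yx ne; rewrite ltnNge le.
Qed.

Lemma flag_fdim_inj (F : flag X) : {in val F &, injective (@fdim X)}.
Proof.
move=> x y Fx Fy xy; apply: subface_anti.
by rewrite !(flag_subface Fx Fy, flag_subface Fy Fx) ?xy.
Qed.

Lemma card_flag (F : flag X) m :
  (forall x : X, fdim x <= m) -> #|val F| <= m.+1.
Proof.
move=> le_m; rewrite -[leqRHS]card_ord.
have injf : {in val F &, injective (fun x : X => inord (fdim x) : 'I_m.+1)}.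
  move=> x y Fx Fy /(congr1 val); rewrite /= !inordK ?ltnS //.
  exact: (flag_fdim_inj Fx Fy).
by rewrite -(card_in_imset injf) max_card.
Qed.

End FlagFacts.

Section DoubleFlags.
Variable X : complex.

(** The smallest member of [s] is contained in all the others, so any of its faces is common to
    all. *)
Lemma double_flag_min (s : flag (barycentric X)) :
  exists x : X, forall F : flag X, F \in val s -> x \in val F.
Proof.
have [F0 sF0] := flag_nonempty s.
case: (@arg_minnP _ F0 (mem (val s)) (fun F : flag X => #|val F|) sF0) => F sF min.
have [x Fx] := flag_nonempty F; exists x => F' sF'.
case/orP: (flag_comparable sF sF') => [/subsetP|F'F]; first by apply.
suff -> : val F' = val F by [].
by apply/eqP; rewrite eqEcard min // andbT; exact: F'F.
Qed.

(** The larger of two members contains both faces; hence all faces occurring in [s] form a single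
    chain. *)
Lemma double_flag_comparable (s : flag (barycentric X)) (F F' : flag X) (x y : X) :
    F \in val s -> F' \in val s -> x \in val F -> y \in val F' ->
  exists2 E : flag X, E \in val s & x \in val E /\ y \in val E.
Proof.
move=> sF sF' Fx Fy; case/orP: (flag_comparable sF sF') => /subsetP sub.
  by exists F' => //; split=> //; apply: sub.
by exists F => //; split=> //; apply: sub.
Qed.

End DoubleFlags.

(** * Counting the flags of flags of cubes near a position *)

Section SimplexCount.
Variables k n : nat.
Let H := honeycomb k n.

Lemma offset5 (m a : nat) :
  m <= a + 2 /\ a <= m + 2 -> exists u : 'I_5, m + 2 = a + u.
Proof.
move=> [ma am]; have lt : m + 2 - a < 5 by lia.
by exists (Ordinal lt); rewrite subnKC.
Qed.

Lemma hi_lo (I : elem_interval n) : hi I = lo I + (lo I < hi I).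
Proof.
rewrite /lo /hi; case/and3P: (valP I) => _; case: (val I) => /= a b; lia.
Qed.

Lemma fdim_cube (x : H) : fdim x <= k.
Proof.
apply: (@leq_trans (\sum_(j < k) 1)); last by rewrite sum1_card card_ord.
by apply: leq_sum => j _; rewrite hi_lo addKn leq_b1.
Qed.

(* In a flag, each coordinate runs through one point and then one interval
   containing it, the switch happening at some dimension [c.2]. Positions are
   offset by 2 from [a] to stay within the natural numbers. *)
Definition interval_code : finType := ('I_5 * 'I_5 * 'I_k.+2)%type.

Definition codes_interval (a : nat) (c : interval_code) (e : nat)
    (I : elem_interval n) : Prop :=
  lo I + 2 = a + (if e < c.2 then c.1.1 else c.1.2) /\
  (lo I < hi I) = (c.2 <= e).

Lemma codes_interval_inj a c e I J :
  codes_interval a c e I -> codes_interval a c e J -> I = J.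
Proof.
move=> [loI hiI] [loJ hiJ].
have lIJ : lo I = lo J by apply: (@addIn 2); rewrite loI loJ.
by apply: elem_interval_inj; rewrite // [LHS]hi_lo [RHS]hi_lo hiI hiJ lIJ.
Qed.

(** The radius 2 allows 1 between the positions of two nearby simplices and 1 between a position and
    the corner of a cube of its simplex. *)
Definition close_to (a : 'I_k -> nat) (s : flag (barycentric H)) : Prop :=
  forall F : flag H, F \in val s -> forall x : cube k n, x \in val F ->
  forall j, lo (x j) <= a j + 2 /\ a j <= lo (x j) + 2.

(** The cubes in [s] form a chain. Along it, coordinate [j] can only pass from a point to an
    interval, and nested points, like nested unit intervals, are equal. *)
Lemma ex_interval_code (a : 'I_k -> nat) (s : flag (barycentric H)) j :
    close_to a s ->
  exists c : interval_code, forall F : flag H, F \in val s ->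
  forall x : cube k n, x \in val F -> codes_interval (a j) c (cube_dim x) (x j).
Proof.
move=> near.
pose inS (x : cube k n) := [exists F : flag H, (F \in val s) && (x \in val F)].
have inSP F x : F \in val s -> x \in val F -> inS x.
  by move=> sF Fx; apply/existsP; exists F; rewrite sF.
have comp x y : inS x -> inS y -> cube_dim x <= cube_dim y -> subcube x y.
  move=> /existsP[F /andP[sF Fx]] /existsP[F' /andP[sF' Fy]].
  have [E _ [Ex Ey]] := double_flag_comparable sF sF' Fx Fy.
  exact: (flag_subface Ex Ey).
have close x : inS x -> lo (x j) <= a j + 2 /\ a j <= lo (x j) + 2.
  by move=> /existsP[F /andP[sF Fx]]; apply: near sF _ Fx j.
pose open (x : cube k n) := lo (x j) < hi (x j).
have openW x y : inS x -> inS y -> cube_dim x <= cube_dim y -> open x -> open y.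
  move=> Sx Sy le; have /forallP/(_ j)/andP[] := comp x y Sx Sy le.
  by rewrite /open; lia.
have lo_eq x y : inS x -> inS y -> open x = open y -> lo (x j) = lo (y j).
  wlog le : x y / cube_dim x <= cube_dim y.
    move=> th Sx Sy e; have [/th->//|/ltnW/th->//] := leqP (cube_dim x) (cube_dim y).
  move=> Sx Sy; have /forallP/(_ j)/andP[] := comp x y Sx Sy le.
  rewrite /open; have := hi_lo (x j); have := hi_lo (y j).
  by case: ltnP => ? ->; case: ltnP => ? -> //; lia.
(* [t] is the least dimension at which coordinate [j] is an interval; the cap [k.+1] means that this
   never happens. *)
have [|t [tmin tex]] := @capped_min _ [pred x | inS x && open x] (@cube_dim k n) k.+1.
  by move=> x _; rewrite ltnS; apply: (fdim_cube x).
have open_t x : inS x -> open x = (t <= cube_dim x).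
  move=> Sx; apply/idP/idP => [ox|le]; first by apply: tmin; rewrite /= Sx.
  have [|y /andP[Sy oy] ty] := tex; last by apply: openW oy => //; rewrite ty.
  by rewrite (leq_ltn_trans le) // ltnS; apply: (fdim_cube x).
have off b : exists u : 'I_5, forall x, inS x -> open x = b -> lo (x j) + 2 = a j + u.
  case: (pickP [pred x : cube k n | inS x && (open x == b)]) => [x /andP[Sx /eqP ox]|none].
    have [u uE] := offset5 (close x Sx).
    by exists u => y Sy oy; rewrite (lo_eq y x) ?ox.
  (* No cube lies on this side of the switch, so any offset will do. *)
  by exists ord0 => x Sx ox; have := none x; rewrite /= Sx ox eqxx.
have [u uP] := off false; have [v vP] := off true.
exists (u, v, t) => F sF x Fx; have Sx := inSP F x sF Fx.
split; last exact: open_t.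
have := open_t x Sx; rewrite /= ltnNge => ot; rewrite -ot.
by case: ifPn => [/negPf|/negPn] ox; [apply: uP | apply: vP].
Qed.

(* A flag of flags is recovered from the cardinalities of its members together
   with, for each dimension [e], the least cardinality of a member having a
   cube of dimension [e]. *)
Definition simplex_code : finType :=
  ({set 'I_k.+2} * {ffun 'I_k.+1 -> 'I_k.+3} * {ffun 'I_k -> interval_code})%type.

Definition codes_simplex (a : 'I_k -> nat) (c : simplex_code)
    (s : flag (barycentric H)) : Prop :=
  [/\ forall m : 'I_k.+2,
        m \in c.1.1 <-> exists2 F : flag H, F \in val s & #|val F| = m,
      forall F : flag H, F \in val s -> forall e : 'I_k.+1,
        (exists2 x : cube k n, x \in val F & cube_dim x = e) <->
        c.1.2 e <= #|val F| &
      forall F : flag H, F \in val s -> forall x : cube k n, x \in val F ->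
        forall j, codes_interval (a j) (c.2 j) (cube_dim x) (x j)].

Lemma card_honeycomb_flag (F : flag H) : #|val F| < k.+2.
Proof. by rewrite ltnS card_flag //; apply: fdim_cube. Qed.

(** A member of [s] is matched with the member of [s'] of the same cardinality. The thresholds give
    both the same dimensions of cubes, and the interval codes then identify the cubes. *)
Lemma codes_simplex_sub a c s s' :
  codes_simplex a c s -> codes_simplex a c s' -> val s \subset val s'.
Proof.
move=> [cs gs ds] [cs' gs' ds']; apply/subsetP => F sF.
have /cs/cs'[F' sF' /= eqF] : exists2 F1 : flag H, F1 \in val s &
    #|val F1| = Ordinal (card_honeycomb_flag F) by exists F.
suff -> : F = F' :> flag H by [].
apply/val_inj/eqP; rewrite eqEcard eqF leqnn andbT; apply/subsetP => x Fx.
have lt : cube_dim x < k.+1 by rewrite ltnS; apply: (fdim_cube x).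
have /(gs _ sF) : exists2 y : cube k n, y \in val F & cube_dim y = Ordinal lt.
  by exists x.
rewrite -eqF => /(gs' _ sF')[y F'y /= dy].
suff -> : x = y by [].
apply/ffunP => j; apply: codes_interval_inj (ds _ sF x Fx j) _.
by rewrite -dy; apply: ds' sF' y F'y j.
Qed.

Lemma ex_simplex_code a s :
  close_to a s -> exists c : simplex_code, codes_simplex a c s.
Proof.
move=> near.
have /fin_all_exists[ic icP] := fun j => ex_interval_code j near.
pose has_dim (F : flag H) (e : nat) := [exists x in val F, cube_dim x == e].
have /fin_all_exists[g gP] (e : 'I_k.+1) : exists m : 'I_k.+3,
    forall F : flag H, F \in val s -> has_dim F e = (m <= #|val F|).
  have [|m [mmin mex]] := @capped_min _ [pred F : flag H | (F \in val s) && has_dim F e]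
      (fun F => #|val F|) k.+2.
    by move=> F _; apply: card_honeycomb_flag.
  exists m => F sF; apply/idP/idP => [Fe|le]; first by apply: mmin; rewrite /= sF.
  have [|F' /andP[sF' /exists_inP[x F'x xe]] F'm] := mex.
    exact: leq_ltn_trans le (card_honeycomb_flag F).
  apply/exists_inP; exists x => //.
  (* Members are nested, so one with at least as many cubes as the minimal [F'] contains [F'], and
     with it the cube of dimension [e]. *)
  case/orP: (flag_comparable sF sF') => [FF'|/subsetP]; last by apply.
  suff -> : val F = val F' by [].
  by apply/eqP; rewrite eqEcard F'm le andbT; exact: FF'.
exists ([set m : 'I_k.+2 | [exists F in val s, #|val F| == m]], finfun g, finfun ic).
split=> /= [m|F sF e|F sF x Fx j].
- rewrite inE; split=> [/exists_inP[F sF /eqP]|[F sF Fm]]; first by exists F.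
  by apply/exists_inP; exists F => //; apply/eqP.
- rewrite ffunE -gP //; split=> [[x Fx xe]|/exists_inP[x Fx /eqP]].
    by apply/exists_inP; exists x => //; apply/eqP.
  by exists x.
- by rewrite ffunE; apply: icP sF _ Fx.
Qed.

Lemma card_close_simplices (a : 'I_k -> nat) (A : {pred flag (barycentric H)}) :
    (forall s, s \in A -> close_to a s) ->
  #|A| <= 2 ^ k.+2 * k.+3 ^ k.+1 * (25 * k.+2) ^ k.
Proof.
move=> near; have <- : #|simplex_code| = 2 ^ k.+2 * k.+3 ^ k.+1 * (25 * k.+2) ^ k.
  by rewrite !card_prod !card_ffun -cardsT -powersetT card_powerset cardsT
             !card_prod !card_ord.
apply: (card_le_code (R := codes_simplex a)) => [s /near|c s s' _ _ cs cs'].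
  by case/ex_simplex_code=> c; exists c.
by apply/val_inj/eqP; rewrite eqEsubset !(codes_simplex_sub _ _ (c := c) (a := a)).
Qed.

End SimplexCount.

(** * Chains of faces and the barycentric simplices they give *)

Section Chains.
Variables (X : complex) (m : nat).

(** The equality, stronger than monotonicity, makes the chain strictly increasing. *)
Definition is_chain (Q : 'I_m.+1 -> X) : Prop :=
  forall i i', subface (Q i) (Q i') = (i <= i').

Variable Q : 'I_m.+1 -> X.
Hypothesis chainQ : is_chain Q.

Lemma chain_inj : injective Q.
Proof.
move=> i i' QQ; apply/val_inj/eqP.
by rewrite eqn_leq -!chainQ QQ subface_refl.
Qed.

Lemma chain_flag (A : {set 'I_m.+1}) : A != set0 -> is_flag (Q @: A).
Proof.
move=> A0; rewrite /is_flag imset_eq0 A0; apply/forall_inP => _ /imsetP[i _ ->].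
by apply/forall_inP => _ /imsetP[i' _ ->]; rewrite !chainQ leq_total.
Qed.

(** The initial segments of a chain are flags, and they form a chain of the same length. *)
Lemma chain_barycentric : exists F : 'I_m.+1 -> barycentric X,
  forall i i', subface (F i) (F i') = (i <= i').
Proof.
have ne (i : 'I_m.+1) : [set l : 'I_m.+1 | l <= i] != set0.
  by apply/set0Pn; exists i; rewrite inE.
exists (fun i => Sub _ (chain_flag (ne i)) : flag X) => i i'.
apply/subsetP/idP => [/(_ (Q i))|le x]; first by
  rewrite !(mem_imset _ _ chain_inj) !inE leqnn => ->.
case/imsetP=> l; rewrite inE => li ->.
by rewrite (mem_imset _ _ chain_inj) inE (leq_trans li).
Qed.

Lemma chain_top_face : exists F : barycentric X, fdim F = m.
Proof.
have ne : [set: 'I_m.+1] != set0 by apply/set0Pn; exists ord0.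
exists (Sub _ (chain_flag ne) : flag X).
by rewrite /= /flag_dim /= card_imset ?cardsT ?card_ord //; apply: chain_inj.
Qed.

End Chains.

(** * Positions of the simplices of the honeycomb *)

Section HoneycombSimplices.
Variables d n : nat.
Let H := honeycomb (2 * d) n.

Lemma honeycomb_chain : 1 < n -> exists Q : 'I_d.+1 -> H, is_chain Q.
Proof.
move=> n_gt1.
have P1 : [&& 0 < (inord 1 : 'I_n.+1, inord 1 : 'I_n.+1).1,
    (inord 1 : 'I_n.+1) <= (inord 1 : 'I_n.+1) &
    (inord 1 : 'I_n.+1) <= (inord 1 : 'I_n.+1).+1].
  by rewrite /= inordK // ltnW.
have P2 : [&& 0 < (inord 1 : 'I_n.+1, inord 2 : 'I_n.+1).1,
    (inord 1 : 'I_n.+1) <= (inord 2 : 'I_n.+1) &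
    (inord 2 : 'I_n.+1) <= (inord 1 : 'I_n.+1).+1].
  by rewrite /= !inordK // ltnW.
pose I1 : elem_interval n := exist _ (_, _) P1.
pose I2 : elem_interval n := exist _ (_, _) P2.
(* The [i]-th cube is [[1, 2]] in its first [i] coordinates and the point 1 in the others. *)
exists (fun i : 'I_d.+1 => [ffun j : 'I_(2 * d) => if j < i then I2 else I1]) => i i'.
apply/forallP/idP => [le|le j].
  rewrite leqNgt; apply/negP => lt.
  (* Coordinate [i'] tells the cubes apart: it is an interval in the [i]-th and a point in the
     [i']-th. *)
  have ltj : i' < 2 * d by have := ltn_ord i; lia.
  by have := le (Ordinal ltj); rewrite !ffunE /= lt ltnn /hi /= !inordK ?andbF // ltnW.
rewrite !ffunE; case: (ltnP j i) => [ji|_]; first by rewrite (leq_trans ji le) !leqnn.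
by case: ifP; rewrite /lo /hi /= !inordK ?leqnn // ltnW.
Qed.

(** An empty graph never reaches a one-vertex trigraph, so a vertex is needed for the twin-width to
    exist. *)
Lemma G_dn_inhabited : 1 < n -> exists s : G_dn d n, True.
Proof.
case/honeycomb_chain=> Q /chain_barycentric[F /chain_top_face[s sd]].
have sd' : fdim s <= d by rewrite sd.
by exists (exist _ (exist _ s sd') (introT eqP sd)).
Qed.

Definition simplex (s : G_dn d n) : flag (barycentric H) := val (val s).

Lemma simplex_inj : injective simplex.
Proof. by move=> s t /val_inj/val_inj. Qed.

Lemma lo_flag (F : flag H) (x y : cube (2 * d) n) j :
  x \in val F -> y \in val F -> lo (x j) <= (lo (y j)).+1.
Proof.
move=> Fx Fy; have := hi_lo (x j); have := hi_lo (y j).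
have: subcube x y || subcube y x by apply: (flag_comparable Fx Fy).
case/orP=> /forallP/(_ j)/andP[]; have := leq_b1 (lo (x j) < hi (x j));
  have := leq_b1 (lo (y j) < hi (y j)); lia.
Qed.

(** The shared face of dimension [d - 1] is a nonempty set of flags, and any of them will do. *)
Lemma adj_common_flag (s t : G_dn d n) : adj s t ->
  exists F : flag H, F \in val (simplex s) /\ F \in val (simplex t).
Proof.
case/andP=> _ /existsP[z /and3P[_ /subsetP zs /subsetP zt]].
have [F zF] := flag_nonempty (val z).
by exists F; split; [apply: zs | apply: zt].
Qed.

(** The count of [card_close_simplices] for [k = 2 * d]; its last factor alone dominates
    [6 ^ (2 * d)]. *)
Definition tww_bound : nat :=
  2 ^ (2 * d).+2 * (2 * d).+3 ^ (2 * d).+1 * (25 * (2 * d).+2) ^ (2 * d).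

Lemma G_dn_twin_width :
  1 < n -> exists2 m, is_twin_width (G_dn d n) m & m <= tww_bound.
Proof.
move=> n_gt1; have [s0 _] := G_dn_inhabited n_gt1.
have /fin_all_exists[c cP] (s : G_dn d n) := double_flag_min (simplex s).
pose pos s : {ffun 'I_(2 * d) -> 'I_n.+1} := [ffun j => (val ((c s : cube _ _) j)).1].
have posE s j : pos s j = lo ((c s : cube _ _) j) :> nat by rewrite ffunE.
apply: (@grid_graph_twin_width _ (2 * d) n _ pos) => // [s t st j||s].
(* The chosen cubes of [s] and [t] both lie in the common flag [F], so their corners differ by at
   most 1. *)
- have [F [sF tF]] := adj_common_flag st.
  by rewrite !posE; apply: lo_flag (cP s F sF) (cP t F tF).
- apply: leq_trans (leq_pmull _ _); last by rewrite muln_gt0 !expn_gt0.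
  by case: (2 * d) => [|k]; rewrite ?expn0 ?leq_exp2r //; lia.
rewrite -(card_imset _ simplex_inj).
apply: (@card_close_simplices _ _ (fun j => pos s j : nat)) => _ /imsetP[t tP ->].
move=> F tF x Fx j; move: tP; rewrite inE => /forallP/(_ j)/andP.
have := lo_flag j Fx (cP t F tF); have := lo_flag j (cP t F tF) Fx.
by rewrite -!posE; lia.
Qed.

End HoneycombSimplices.

(** * The estimate [d ^ O(d)] and the conclusion *)

(** For [d >= 8] the bases 2, [2 * d + 3] and [25 * (2 * d + 2)] are at most [d], [d ^ 2] and
    [d ^ 3], and the exponents at most [4 * d], [3 * d] and [2 * d]; this gives [16 = 4 + 6 + 6]. *)
Lemma tww_bound_le d : 8 <= d -> tww_bound d <= d ^ (16 * d).
Proof.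
move=> d8; have d1 : 0 < d by lia.
have -> : d ^ (16 * d) = d ^ (4 * d) * (d ^ 2) ^ (3 * d) * (d ^ 3) ^ (2 * d).
  by rewrite -!expnM -!expnD; congr (_ ^ _); lia.
apply: leq_mul; first apply: leq_mul.
- apply: (@leq_trans (d ^ (2 * d).+2)); first by rewrite leq_exp2r; lia.
  by rewrite leq_pexp2l; lia.
- apply: (@leq_trans ((d ^ 2) ^ (2 * d).+1)); first by rewrite leq_exp2r; nia.
  by rewrite leq_pexp2l ?expn_gt0 ?d1 //; lia.
- by rewrite leq_exp2r; nia.
Qed.

Import Order.TTheory GRing.Theory Num.Theory.
Local Open Scope ring_scope.

Theorem theorem19 (R : realType) :
  exists f : nat -> R,
    [/\ forall d : nat, (1 <= d)%N -> 0 <= f d,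
        d_pow_O_d f &
        forall d n : nat, (1 <= d)%N -> (2 <= n)%N ->
          exists k : nat, is_twin_width (G_dn d n) k /\ k%:R <= f d].
Proof.
exists (fun d => (tww_bound d)%:R); split=> [d _||d n _ n2]; first exact: ler0n.
  exists 16%:R, 8%:R; split=> [||d]; rewrite ?ltr0n // ler_nat => d8.
  by rewrite -natrM powR_mulrn ?ler0n // -natrX ler_nat tww_bound_le.
have [k tk kB] := G_dn_twin_width d n2.
by exists k; split=> //; rewrite ler_nat.
Qed.
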